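(* Let $p$ be an odd prime and $i\in\{1,2\}$, and suppose that $\mathrm{Rog}_i(p)$ is non-empty. Then $$|C_i[p]|\le\min\{\operatorname{ord}_{A_i^q}(p) : q\in\mathrm{Rog}_i(p)\}.$$
   Context: Cunningham chain: for an odd prime $p$ and $i\in\{1,2\}$, set $a_n=2^{n-1}p+(-1)^{i+1}(2^{n-1}-1)$ for $n\ge1$ (so $a_1=p$, $a_{n+1}=2a_n+(-1)^{i+1}$), let $k$ be the largest integer such that $a_1,\dots,a_k$ are all prime, and $C_i[p]=\{a_1,\dots,a_k\}$, so $|C_i[p]|=k$. Rogue sets: for an odd prime $q$, $A_i^q=(\mathbb{Z}/q\mathbb{Z})^\times\setminus\{(-1)^i\bmod q\}$. For $g\in A_i^q$ define $u_1=g$, $u_n=2u_{n-1}+(-1)^{i+1}$ in $\mathbb{Z}/q\mathbb{Z}$, $g_k^i=\min(\{n:u_n=0\}\cup\{\infty\})$, and the rogue sequence $\langle g\rangle_i^q=(u_n)_{1\le n<g_k^i}$. Let $R_i^q=\{(a,b)\in A_i^q\times A_i^q: a \text{ is a term of }\langle b\rangle_i^q\text{ or } b\text{ is a term of }\langle a\rangle_i^q\}$. For $n\in\mathbb{N}$, $\mathrm{Rog}_i(n)$ is the set of odd primes $q<n$ such that $n\bmod q\in A_i^q$ and $(n\bmod q,(-1)^{i+1})\in R_i^q$ (primes corogue to $n$). For $q\in\mathrm{Rog}_i(n)$, writing $\langle(-1)^{i+1}\rangle_i^q=(u_n)$ and letting $k$ be the index with $u_k\equiv n\pmod q$, the order of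 $n$ in $A_i^q$ is $\operatorname{ord}_{A_i^q}(n)=O_q(2)-1-k$, where $O_q(2)$ is the multiplicative order of $2$ modulo $q$.
   Formalization: In the order O_q(2)-1-k the index k of p mod q in the rogue sequence of (-1)^{i+1} is counted from 0, not from 1, so the order is larger by 1; with k counted from 1 the bound is false (p=7, i=1, q=3 gives 1 ≤ 0). *)

(* Defs.v *)
From mathcomp Require Import all_boot all_order all_fingroup all_algebra finmap.
From mathcomp Require Import boolp classical_sets.

Set Implicit Arguments.
Unset Strict Implicit.
Unset Printing Implicit Defensive.

Import Order.TTheory GRing.Theory Num.Theory.

Local Open Scope classical_set_scope.
Local Open Scope ring_scope.

(* Least, resp. greatest, element of a set of naturals; 0 if there is none. *)
Definition nat_min (S : set nat) : nat :=
  xget 0%N [set m | S m /\ forall m', S m' -> (m <= m')%N].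

Definition nat_max (S : set nat) : nat :=
  xget 0%N [set m | S m /\ forall m', S m' -> (m' <= m)%N].

Definition cunningham_term (i p n : nat) : int :=
  2 ^+ n.-1 * p%:Z + (-1) ^+ i.+1 * (2 ^+ n.-1 - 1).

(* The terms are positive for p >= 1, so taking absolute values only casts    *)
(* them to nat.                                                               *)
Definition cunningham_prime_upto (i p k : nat) : Prop :=
  forall n, (1 <= n <= k)%N -> prime `|cunningham_term i p n|%N.

(* The greatest such k exists for every odd prime p: p divides the p-th term, *)
(* which is larger than p.                                                    *)
Definition cunningham_length (i p : nat) : nat :=
  nat_max [set k | cunningham_prime_upto i p k].

Definition cunningham_chain (i p : nat) : {fset int} :=
  [fset x in [seq cunningham_term i p n | n <- iota 1 (cunningham_length i p)]]%fset.

Definition rogueA (i q : nat) : set 'Z_q :=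
  [set x | x \is a GRing.unit /\ x <> (-1) ^+ i].

(* u_n, indexed from u_1 = g (the value at n = 0 is irrelevant). *)
Definition rogue_term (i q : nat) (g : 'Z_q) (n : nat) : 'Z_q :=
  iter n.-1 (fun x => 2 * x + (-1) ^+ i.+1) g.

Definition rogue_zeros (i q : nat) (g : 'Z_q) : set nat :=
  [set n | (1 <= n)%N /\ rogue_term i g n = 0].

(* None stands for infinity. *)
Definition rogue_stop (i q : nat) (g : 'Z_q) : option nat :=
  if `[< rogue_zeros i g !=set0 >] then Some (nat_min (rogue_zeros i g))
  else None.

Definition rogue_index (i q : nat) (g : 'Z_q) : set nat :=
  [set n | (1 <= n)%N /\ if rogue_stop i g is Some s then (n < s)%N else True].

Definition rogue_seq_term (i q : nat) (g a : 'Z_q) : Prop :=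
  exists2 n, rogue_index i g n & rogue_term i g n = a.

Definition rogueR (i q : nat) : set ('Z_q * 'Z_q) :=
  [set ab | [/\ rogueA i ab.1, rogueA i ab.2 &
     rogue_seq_term i ab.2 ab.1 \/ rogue_seq_term i ab.1 ab.2]].

Definition Rog (i n : nat) : set nat :=
  [set q | [/\ prime q, odd q, (q < n)%N, rogueA i (n%:R : 'Z_q) &
     rogueR i (n%:R : 'Z_q, (-1) ^+ i.+1)]].

(* Multiplicative order of 2 in (Z/qZ)^*, for odd q (where 2 is a unit). *)
Definition mult_order2 (q : nat) : nat :=
  #[insubd (1%g : {unit 'Z_q}) (2%:R : 'Z_q)]%g.

(* Position of n mod q in the rogue sequence of (-1)^(i+1), counted from 0,   *)
(* i.e. the number of terms that precede it.                                  *)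
Definition rogue_pos (i q n : nat) : nat :=
  xget 0%N [set k | rogue_index i ((-1) ^+ i.+1 : 'Z_q) k.+1 /\
                    rogue_term i ((-1) ^+ i.+1 : 'Z_q) k.+1 = n%:R].

(* The rogue sequence of (-1)^(i+1) has mult_order2 q - 1 terms, so this is   *)
(* the number of its terms from n mod q on, and the subtractions are exact.   *)
(* Counting the position from 1 here instead would make the order of the last *)
(* term 0 and the bound |C_i[p]| <= min ord false: for i = 1 and p = 7 one    *)
(* has |C_1[7]| = 1, 3 is in Rog_1(7), O_3(2) = 2, and 7 is congruent to the  *)
(* first term of the sequence.                                                *)
Definition rogue_ord (i q n : nat) : nat :=
  (mult_order2 q - 1 - rogue_pos i q n)%N.

(* Main.v *)
(** Write e = (-1)^(i+1).  Both recurrences read x + e |-> 2 (x + e), so modulo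
    q the rogue sequence of e is u_n = e (2^n - 1), which first vanishes at
    n = O_q(2).  Being corogue to p means p = e (2^(k+1) - 1) modulo q for some
    k + 1 < O_q(2), and then a_n = e (2^(n+k) - 1) modulo q.  Hence q divides
    the term of index O_q(2) - k, which is at least p > q and so not prime. *)

Require Import Defs.
From mathcomp Require Import all_boot all_order all_fingroup all_algebra finmap.
From mathcomp Require Import boolp classical_sets.
From mathcomp Require Import cyclic ring.

Local Open Scope classical_set_scope.

Import Order.TTheory GRing.Theory Num.Theory.

Lemma nat_minP (S : set nat) : S !=set0 ->
  S (nat_min S) /\ forall m, S m -> (nat_min S <= m)%N.
Proof.
case=> n Sn.
suff /(xgetPex 0%N) : exists m, S m /\ forall m', S m' -> (m <= m')%N by [].
have exS : exists n, `[< S n >] by exists n; apply/asboolP.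
case: (ex_minnP exS) => m /asboolP Sm minm; exists m; split=> // m' Sm'.
by apply: minm; apply/asboolP.
Qed.

Lemma cunningham_length_prime (i p : nat) :
  cunningham_prime_upto i p (cunningham_length i p).
Proof.
rewrite /cunningham_length /nat_max; case: xgetP => [k _ [] //|_ n].
(* If there is no greatest [k], the default length 0 leaves an empty range of indices. *)
by case: n.
Qed.

Lemma card_cunningham_chain (i p : nat) :
  (#|` cunningham_chain i p| <= cunningham_length i p)%N.
Proof.
rewrite /cunningham_chain card_fseq (leq_trans (size_undup _)) //.
by rewrite size_map size_iota.
Qed.

Local Open Scope ring_scope.

Lemma sign_cases (i : nat) : (-1) ^+ i = 1 :> int \/ (-1) ^+ i = - 1%:Z.
Proof. by rewrite -signr_odd; case: (odd i); [right|left]. Qed.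

(** The difference factors as [(2 ^+ n.-1 - 1) * (p + e)] with [e] = 1 or -1, and both factors are
    nonnegative. *)
Lemma cunningham_term_ge (i p n : nat) : (0 < p)%N ->
  p%:Z <= cunningham_term i p n.
Proof.
move=> p_gt0; rewrite -subr_ge0 /cunningham_term.
have -> : 2 ^+ n.-1 * p%:Z + (-1) ^+ i.+1 * (2 ^+ n.-1 - 1) - p%:Z =
    (2 ^+ n.-1 - 1) * (p%:Z + (-1) ^+ i.+1) by ring.
apply: mulr_ge0; first by rewrite subr_ge0 exprn_ege1 ?ler1n.
by case: (sign_cases i.+1) => ->; rewrite ?subr_ge0 ?lez_nat // addr_ge0.
Qed.

Lemma cunningham_term_abs (i p n : nat) : (0 < p)%N ->
  `|cunningham_term i p n|%N%:Z = cunningham_term i p n.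
Proof.
move=> p_gt0; apply: gez0_abs.
exact: le_trans (cunningham_term_ge i p n p_gt0).
Qed.

Section OddPrime.

Variables (i q : nat).
Hypotheses (q_prime : prime q) (q_odd : odd q).

Let q_gt1 : (1 < q)%N := prime_gt1 q_prime.
Let e : 'Z_q := (-1) ^+ i.+1.

Lemma unit2_Zp : (2 : 'Z_q) \is a GRing.unit.
Proof. by rewrite unitZpE // coprimen2. Qed.

Lemma mult_order2_gt0 : (0 < mult_order2 q)%N.
Proof. exact: order_gt0. Qed.

Lemma mult_order2_dvdn (n : nat) :
  (mult_order2 q %| n)%N = (2 ^+ n == 1 :> 'Z_q).
Proof.
rewrite /mult_order2 order_dvdn -val_eqE FinRing.val_unitX val_insubd /=.
(* Since 2 is a unit, [insubd] yields 2 itself rather than its default 1. *)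
by rewrite unit2_Zp.
Qed.

Lemma rogue_termE (g : 'Z_q) (n : nat) :
  rogue_term i g n = 2 ^+ n.-1 * (g + e) - e.
Proof.
rewrite /rogue_term; elim: n.-1 => [|m IH] /=; first by rewrite mul1r addrK.
by rewrite IH -/e exprS; ring.
Qed.

Lemma rogue_term_sign (n : nat) :
  rogue_term i e n.+1 = e * (2 ^+ n.+1 - 1).
Proof. by rewrite rogue_termE /= exprS; ring. Qed.

Lemma rogue_term_sign_eq0 (n : nat) :
  rogue_term i e n.+1 = 0 <-> (mult_order2 q %| n.+1)%N.
Proof.
rewrite rogue_term_sign mult_order2_dvdn -[_ == 1]subr_eq0.
(* The sign [e] is its own inverse, so multiplying by it cancels it. *)
split=> [/(congr1 (fun x => e * x))|/eqP ->]; last by rewrite mulr0.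
by rewrite mulrA mulr0 -expr2 sqrr_sign mul1r => ->.
Qed.

Lemma rogue_index_sign (n : nat) :
  rogue_index i e n <-> (1 <= n < mult_order2 q)%N.
Proof.
have zero_order : rogue_zeros i e (mult_order2 q).
  split; first exact: mult_order2_gt0.
  rewrite -(prednK mult_order2_gt0); apply/rogue_term_sign_eq0.
  by rewrite (prednK mult_order2_gt0).
have ne0 : rogue_zeros i e !=set0 by exists (mult_order2 q).
have [[s_gt0 s_zero] s_min] := nat_minP _ ne0.
have stopE : nat_min (rogue_zeros i e) = mult_order2 q.
  apply/eqP; rewrite eqn_leq s_min //= dvdn_leq //.
  by rewrite -(prednK s_gt0); apply/rogue_term_sign_eq0; rewrite prednK.
rewrite /rogue_index /rogue_stop asboolT //= stopE.
by split=> [[-> ->]|/andP[]].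
Qed.

(** If [n] is a term of the sequence of [e], this is the closed form. If [e] is the [m]-th term of
    the sequence of [n], then [2 ^+ m.-1 * (n + e) = 2 * e], and undoing the doublings makes [n + e]
    a power of 2 times [e]. *)
Lemma corogue_pos (n : nat) : rogueR i (n%:R : 'Z_q, e) ->
  exists k, (k.+1 < mult_order2 q)%N /\ n%:R = e * (2 ^+ k.+1 - 1).
Proof.
case=> /= -[n_unit _] _ [] [m] m_idx.
  have /andP[m_gt0 m_lt] := (rogue_index_sign m).1 m_idx.
  by case: m m_gt0 m_lt {m_idx} => // k _ k_lt <-; exists k; rewrite rogue_term_sign.
rewrite rogue_termE => /(canRL (subrK _)) m_eq.
have order_pow (a : nat) : 2 ^+ (a * mult_order2 q)%N = 1 :> 'Z_q.
  by apply/eqP; rewrite -mult_order2_dvdn dvdn_mull.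
(* Reducing modulo the order makes the backward step from e to n a forward one. *)
pose b := (1 + (mult_order2 q).-1 * m.-1)%N.
have [r r_lt r_pow] : exists2 r, (r < mult_order2 q)%N & 2 ^+ r = 2 ^+ b :> 'Z_q.
  exists (b %% mult_order2 q)%N; first by rewrite ltn_mod mult_order2_gt0.
  by rewrite [in RHS](divn_eq b (mult_order2 q)) exprD order_pow mul1r.
have nE : n%:R + e = 2 ^+ r * e.
  (* After multiplication by 2, [m_eq] applies, and [b + m.-1] is 1 plus a multiple of the order. *)
  apply: (mulrI unit2_Zp).
  have -> : 2 * (2 ^+ r * e) = 2 ^+ b * (2 ^+ m.-1 * (n%:R + e)).
    by rewrite -r_pow m_eq -mulr2n mulrCA mulr_natl.
  rewrite mulrA -exprD /b -addnA -mulSnr (prednK mult_order2_gt0) mulnC.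
  by rewrite exprD order_pow mulr1.
have {nE} nE : n%:R = e * (2 ^+ r - 1).
  by rewrite -[LHS](addrK e) nE; ring.
(* The exponent 0 would make [n] zero modulo [q], hence not a unit. *)
case: r r_lt nE {r_pow} => [_|k k_lt] nE; last by exists k.
by move: n_unit; rewrite nE subrr mulr0 unitr0.
Qed.

Lemma rogue_posP (n : nat) : rogueR i (n%:R : 'Z_q, e) ->
  ((rogue_pos i q n).+1 < mult_order2 q)%N /\
  n%:R = e * (2 ^+ (rogue_pos i q n).+1 - 1).
Proof.
move=> /corogue_pos [k [k_lt nE]].
have := @xgetPex _ 0%N [set k | rogue_index i e k.+1 /\
  rogue_term i e k.+1 = n%:R].
rewrite -/(rogue_pos i q n) => -[|/rogue_index_sign /andP[_ ?]].
  by exists k; split; [apply/rogue_index_sign|rewrite rogue_term_sign].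
by rewrite rogue_term_sign.
Qed.

(** Modulo [q] the Cunningham term is [2 ^+ n.-1 * (p + e) - e]. *)
Lemma dvdn_cunningham_term (p n : nat) : (0 < p)%N ->
  2 ^+ n.-1 * (p%:R + e) = e -> (q %| `|cunningham_term i p n|)%N.
Proof.
move=> p_gt0 pE.
have a0 : `|cunningham_term i p n|%N%:R = 0 :> 'Z_q.
  rewrite -[LHS]/(`|cunningham_term i p n|%N%:Z%:~R) cunningham_term_abs //.
  rewrite /cunningham_term rmorphD !rmorphM rmorphB !rmorphXn /= rmorphN1 -/e.
  transitivity (2 ^+ n.-1 * (p%:R + e) - e); last by rewrite pE subrr.
  by ring.
by rewrite /dvdn -val_Zp_nat // a0.
Qed.

Lemma cunningham_length_le_ord (p : nat) : (q < p)%N ->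
  rogueR i (p%:R : 'Z_q, e) -> (cunningham_length i p <= rogue_ord i q p)%N.
Proof.
move=> q_lt /rogue_posP[]; rewrite /rogue_ord; set k := rogue_pos i q p.
move=> k_lt pE; rewrite leqNgt; apply/negP => len_gt.
have p_gt0 : (0 < p)%N by apply: leq_trans q_lt.
(* This is the first index beyond the bound. As [p + e = e * 2 ^+ k.+1], the [n.-1] doublings
   complete the exponent to the order of 2. *)
pose n := (mult_order2 q - k.+1).+1.
have /cunningham_length_prime a_prime : (1 <= n <= cunningham_length i p)%N.
  by rewrite /n /= -addn1 -[k.+1]add1n subnDA addn1.
have /dvdn_cunningham_term : 2 ^+ n.-1 * (p%:R + e) = e.
  rewrite pE mulrBr mulr1 subrK mulrCA -exprD /n /= subnK ?(ltnW k_lt) //.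
  have /eqP -> : 2 ^+ mult_order2 q == 1 :> 'Z_q by rewrite -mult_order2_dvdn.
  exact: mulr1.
(* A prime term divisible by [q] equals [q], but every term is at least [p > q]. *)
move=> /(_ p_gt0); rewrite dvdn_prime2 // => /eqP qE.
have := cunningham_term_ge i p n p_gt0.
by rewrite -cunningham_term_abs // -qE lez_nat leqNgt q_lt.
Qed.

End OddPrime.

Local Close Scope ring_scope.

Theorem mainTheorem9 (p i : nat) (hp : prime p) (hodd : odd p)
    (hi : i = 1 \/ i = 2) (hRog : Rog i p !=set0) :
  (#|` cunningham_chain i p | <=
     nat_min [set rogue_ord i q p | q in Rog i p])%N.
Proof.
(* The minimum over a non-empty set is attained at some corogue [q], so the bound for that [q]
   suffices. *)
have [|[q [q_prime q_odd q_lt _ pR] <-] _] :=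
  @nat_minP [set rogue_ord i q p | q in Rog i p].
  by case: hRog => q qR; exists (rogue_ord i q p), q.
apply: leq_trans (card_cunningham_chain i p) _.
exact: cunningham_length_le_ord.
Qed.
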